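(* Let $B(t)=\sum_{n\ge1}B_n\frac{t^n}{n!}\in\mathbb{C}[[t]]$ with $B_1\ne0$, and let $m\ge-1$. The generalized umbral shift attached to $B(t)$, $\mathcal{D}_{B}(m):\mathbb{C}[x] \rightarrow \mathbb{C}[x]$, is characterized as the unique linear map satisfying, for all $n\ge0$, $$\mathcal{D}_{B}(m)B_{n}(x)=f_{m}(n)B_{n-m}(x),$$ where by convention $B_{n}(x)=0$ for $n \leq -1$.
   Context: The umbral sequence $B_n(x)$ attached to $B$ is defined by $e^{xB(w)}=\sum_{n\ge0}B_n(x)\frac{w^n}{n!}$. $y,x_1,x_2,\dots$ are commuting formal variables. On $y\mathbb{C}[x_1,x_2,x_3,\dots]$ define operators $h(n)$, $n\in\mathbb{Z}$: $h(n)=\frac{1}{(-n-1)!}x_{-n}$ (multiplication) for $n<0$; $h(n)=n!\frac{\partial}{\partial x_n}$ for $n>0$; $h(0)=y\frac{\partial}{\partial y}$ (the identity operator on this space). Set $$L(n)=\frac12\sum_{k\in\mathbb{Z}}h(n-k)h(k)\quad(n\ne0),\qquad L(0)=\frac12\sum_{k\in\mathbb{Z}}h(-|k|)h(|k|),$$ which form a representation of the Virasoro algebra of central charge $1$: $[L(m),L(n)]=(m-n)L(m+n)+\frac1{12}(m^3-m)\delta_{m+n,0}$. $\phi_B:y\mathbb{C}[x_1,x_2,\dots]\to\mathbb{C}[x]$ is the substitution map (restriction of an algebra homomorphism) with $x_j\mapsto B_jx$ ($j\ge1$) and $y\mapsto1$. One has $\phi_B(L(-1)^ny)=B_n(x)$,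 which has degree exactly $n$. For $m\ge-1$, the generalized attached umbral shift $\mathcal{D}_B(m)$ is defined as the unique linear map $\mathbb{C}[x]\to\mathbb{C}[x]$ satisfying $\mathcal{D}_{B}(m) \circ \phi_{B} \circ L(-1)^{n}y=\phi_{B} \circ L(m)L(-1)^{n}y$ for all $n\ge0$. The numbers $f_m(n)$, for $m\ge-1$, $n\ge0$, $n\ge m$, are the rational numbers determined by $L(m)L(-1)^{n}y=f_{m}(n)L(-1)^{n-m}y$ (such numbers exist). They are extended to all $m\ge -1$, $n\in\mathbb{Z}$ as the solution of the recurrence $f_{m}(n)=f_{m}(n-1)+(m+1)f_{m-1}(n-1)$ with $f_{-1}(n)=1$, $f_0(0)=1/2$ and $f_m(0)=0$ for $m\ge1$. *)

(* Defs.v *)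
From HB Require Import structures.
From mathcomp Require Import all_boot all_order all_algebra.
From mathcomp Require Import finmap.
From mathcomp Require Import boolp classical_sets cardinality fsbigop reals.
From mathcomp.real_closed Require Import complex.
From mathcomp.multinomials Require Import monalg.

Set Implicit Arguments.
Unset Strict Implicit.
Unset Printing Implicit Defensive.

Import Order.TTheory GRing.Theory Num.Theory.

Local Open Scope classical_set_scope.
Local Open Scope ring_scope.

(* A formal power series over A is the sequence of its coefficients. *)
Section PowerSeries.
Variables (K : fieldType) (A : lalgType K).
Implicit Types s t : nat -> A.

Definition fps_one : nat -> A := fun n => (n == 0%N)%:R.

Definition fps_mul s t : nat -> A :=
  fun n => \sum_(i < n.+1) s i * t (n - i)%N.

Definition fps_pow s (k : nat) : nat -> A := iter k (fps_mul s) fps_one.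

(* Meaningful when s 0 = 0: the sum over k then has finite support. *)
Definition fps_exp s : nat -> A :=
  fun n => \sum_(k \in [set: nat]) (k`!%:R : K)^-1 *: fps_pow s k n.

End PowerSeries.

Section Umbral.
Variable K : numFieldType.
Implicit Types (B : nat -> K) (D : {poly K} -> {poly K}).

(* The number B_n is B n, so that B(t) is the exponential generating function
   of B; it has no constant term exactly when B 0 = 0. *)
Definition egf B : nat -> K := fun n => B n / n`!%:R.

(* B_n(x), read off from e^(x B(w)) = sum_n B_n(x) w^n / n!. *)
Definition umbral B (n : nat) : {poly K} :=
  n`!%:R *: fps_exp (fun k => egf B k *: ('X : {poly K})) n.

Definition umbralz B (n : int) : {poly K} :=
  if n is Posz k then umbral B k else 0.

(* The polynomial ring C[y, x_1, x_2, ...]; variable number 0 is y and variable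
   number j >= 1 is x_j. The operators below are defined on the whole ring;
   they preserve y C[x_1, x_2, ...], on which h 0 is the identity. *)
Local Notation P := {malg K[{cmonom nat}]}.

Definition var (i : nat) : P := << ucm i >>.

Definition partial (i : nat) (p : P) : P :=
  \sum_(u <- msupp p) << (u i)%:R * p@_u *g divcm u (ucm i) >>.

Definition h (n : int) (p : P) : P :=
  match n with
  | Posz 0 => var 0 * partial 0 p
  | Posz k => k`!%:R *: partial k p
  | Negz k => (k`!%:R)^-1 *: (var k.+1 * p) (* here n = - (k + 1) *)
  end.

(* For every p only finitely many terms of these sums are nonzero. *)
Definition L (n : int) (p : P) : P :=
  2^-1 *: (if n == 0 then \sum_(k \in [set: int]) h (- `|k|) (h `|k| p)
           else \sum_(k \in [set: int]) h (n - k) (h k p)).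

Definition Lm1_iter (n : nat) : P := iter n (L (-1)) (var 0).

Definition phi_var B (i : nat) : {poly K} :=
  if i == 0%N then 1 else B i *: 'X.

Definition phi B : P -> {poly K} :=
  mmap (@polyC K)
    (fun u : {cmonom nat} => \prod_(i <- finsupp u) phi_var B i ^+ u i).

Definition umbral_shift_spec B (m : int) D : Prop :=
  linear D /\
  forall n : nat, D (phi B (Lm1_iter n)) = phi B (L m (Lm1_iter n)).

Definition umbral_shift B (m : int) : {poly K} -> {poly K} :=
  xget (fun=> 0) [set D | unique (umbral_shift_spec B m) D].

(* The first clause determines f m n for n >= max(m, 0), the others extend it
   to all integers n. *)
Definition fcoef_spec (f : int -> int -> rat) : Prop :=
  [/\ forall m n : int, -1 <= m -> 0 <= n -> m <= n ->
        L m (Lm1_iter `|n|) = ratr (f m n) *: Lm1_iter `|n - m|,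
      forall m n : int, 0 <= m ->
        f m n = f m (n - 1) + (m + 1)%:~R * f (m - 1) (n - 1),
      forall n : int, f (-1) n = 1,
      f 0 0 = 2^-1
    & forall m : int, 1 <= m -> f m 0 = 0].

(* Meaningful for m >= -1 only. *)
Definition fcoef : int -> int -> rat := xget (fun _ _ => 0) fcoef_spec.

End Umbral.

Arguments fcoef K : clear implicits.

(* Main.v *)
(* Put e_n = L(-1)^n y / n! and e_n = 0 for n < 0. The Heisenberg relations give,
   by induction on n, h(k) e_n = e_{n-k} for k >= 0 together with
   sum_{j >= 0} h(-j-1) e_{n-1-j} = n e_n. Splitting the sum that defines L(m)
   into its m + 1 terms with both indices nonnegative and two tails of the second
   kind yields L(m) e_n = (n - m + (m + 1) / 2) e_{n-m}; this gives a closed form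
   for f_m(n) and the vanishing of L(m) L(-1)^n y for n < m. The second relation
   is mapped by phi_B to the differential equation F' = x B' F, which identifies
   phi_B(L(-1)^n y) with B_n(x). As B_1 <> 0, B_n(x) has degree n, so the B_n(x)
   form a basis of the polynomials and the two characterizations agree. *)

Require Import Defs.
From mathcomp Require Import all_boot all_order all_algebra.
From mathcomp Require Import zify ring.
From mathcomp Require Import finmap boolp classical_sets cardinality fsbigop reals.
From mathcomp.real_closed Require Import complex.
From mathcomp.multinomials Require Import monalg.

Set Implicit Arguments.
Unset Strict Implicit.
Unset Printing Implicit Defensive.

Import Order.TTheory GRing.Theory Num.Theory.

Local Open Scope ring_scope.

(** * Linear maps and sums of finite support *)

Lemma sum_linear (K : nzRingType) (V : lmodType K) (T : Type) (s : seq T)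
    (F F1 F2 : T -> V) c :
  (forall u, F u = c *: F1 u + F2 u) ->
  \sum_(u <- s) F u = c *: (\sum_(u <- s) F1 u) + \sum_(u <- s) F2 u.
Proof.
by move=> FE; rewrite scaler_sumr -big_split; apply: eq_bigr => u _; apply: FE.
Qed.

Lemma linear_zero (K : nzRingType) (V W : lmodType K) (f : V -> W) :
  linear f -> f 0 = 0.
Proof. by move=> l; have := l (-1) 0 0; rewrite scaler0 addr0 scaleN1r addNr. Qed.

Lemma linear_scale (K : nzRingType) (V W : lmodType K) (f : V -> W) c u :
  linear f -> f (c *: u) = c *: f u.
Proof. by move=> l; have := l c u 0; rewrite (linear_zero l) !addr0. Qed.

Lemma linear_sum_morph (K : nzRingType) (V W : lmodType K) (T : Type) (s : seq T)
    (f : V -> W) (F : T -> V) :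
  linear f -> f (\sum_(u <- s) F u) = \sum_(u <- s) f (F u).
Proof.
move=> l; apply: (big_morph f); last exact: linear_zero.
by move=> a b; have := l 1 a b; rewrite !scale1r.
Qed.

(** Makes the sums over all integers in [L] finite, with separate cutoffs on the two constructors of
    [int]. *)
Lemma fsbig_int (V : nmodType) (F : int -> V) (a b : nat) :
  (forall i, (a <= i)%N -> F (Posz i) = 0) ->
  (forall i, (b <= i)%N -> F (Negz i) = 0) ->
  \sum_(k \in [set: int]) F k = \sum_(i < a) F (Posz i) + \sum_(i < b) F (Negz i).
Proof.
move=> Fa Fb.
rewrite (@fsbigE _ _ _ _ _ ([seq Posz i | i <- iota 0 a] ++ [seq Negz i | i <- iota 0 b])).
- rewrite (eq_bigl xpredT); last by move=> i; rewrite mem_set.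
  rewrite big_cat !big_map.
  rewrite -(big_mkord xpredT (fun i => F (Posz i))).
  by rewrite -(big_mkord xpredT (fun i => F (Negz i))) /index_iota !subn0.
- rewrite cat_uniq !map_inj_uniq ?iota_uniq ?andbT //=; try by move=> i j [].
  by apply/hasPn => x /mapP[i _ ->]; apply/mapP => -[].
- by [].
- move=> [] i _; rewrite mem_cat => /norP[h1 h2].
  + apply: Fa; rewrite leqNgt; apply: contra h1 => h1.
    by rewrite map_f // mem_iota.
  + apply: Fb; rewrite leqNgt; apply: contra h2 => h2.
    by rewrite map_f // mem_iota.
Qed.

(** A nonzero scalar preserves the support, so both sums are finite or both take the default value
    0. *)
Lemma fsbig_scaler (K : fieldType) (V : lmodType K) (T : choiceType)
    (A : set T) (c : K) (F : T -> V) : c != 0 ->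
  \sum_(k \in A) c *: F k = c *: \sum_(k \in A) F k.
Proof.
move=> c0.
have eS : (A `&` (fun k => c *: F k) @^-1` [set~ 0] =
           A `&` F @^-1` [set~ 0])%classic.
  apply/seteqP; split=> x [Ax Fx]; split=> //=.
    by move=> F0; apply: Fx => /=; rewrite F0 scaler0.
  by move=> /eqP; rewrite scaler_eq0 (negbTE c0) /= => /eqP.
have [fS|iS] := pselect (finite_set (A `&` F @^-1` [set~ 0])%classic).
  by rewrite fsbig_supp [in RHS]fsbig_supp eS !fsbig_finite // scaler_sumr.
by rewrite !fsbig_dflt ?scaler0 //; rewrite eS.
Qed.

(** * Heisenberg and Virasoro operators on an abstract module *)

Section Oscillator.
Variables (K : numFieldType) (V : lmodType K) (h : int -> V -> V) (v0 : V).
Hypothesis h_lin : forall n, linear (h n).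
Hypothesis h_comm : forall (a b : nat) u,
  h a (h (Negz b) u) = h (Negz b) (h a u) + (a%:R *+ (a == b.+1)) *: u.
Hypothesis h_vac : forall a : nat, h a v0 = if a == 0%N then v0 else 0.

Definition osc_vir (n : int) (v : V) : V :=
  2^-1 *: (if n == 0 then \sum_(k \in [set: int]) h (- `|k|) (h `|k| v)
           else \sum_(k \in [set: int]) h (n - k) (h k v)).

(* With the operators of the theorem these are the coefficients of the vertex
   operator y exp(sum_j x_j t^j / j!), extended by 0 to negative indices. *)
Definition osc_exp (n : int) : V :=
  if n is Posz k then (k`!%:R)^-1 *: iter k (osc_vir (-1)) v0 else 0.

Local Notation e := osc_exp.

Let h0 n : h n 0 = 0.
Proof. exact: linear_zero. Qed.

Let hZ n c u : h n (c *: u) = c *: h n u.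
Proof. exact: linear_scale. Qed.

(** With the operators of the theorem and N >= q, this is the coefficient of t^q in t S'(t) E(t),
    where S = sum_j x_j t^j / j! and E = y exp S. *)
Definition osc_raise (N : nat) (q : int) : V :=
  \sum_(j < N) h (Negz j) (e (q - 1 - j%:Z)).

Let e_neg (q : int) : q < 0 -> e q = 0.
Proof. by case: q. Qed.

Lemma osc_raise_widen (N : nat) (q : int) : q <= N%:Z ->
  \sum_(j < N) h (Negz j) (e (q - 1 - j%:Z)) = osc_raise `|q| q.
Proof.
move=> qN; have lqN : 0 <= q -> (`|q| <= N)%N by lia.
case: (ltP q 0) => q0.
  rewrite /osc_raise !big1 // => i _; rewrite e_neg ?h0 //; lia.
rewrite /osc_raise -!(big_mkord xpredT (fun j => h (Negz j) (e (q - 1 - j%:Z)))).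
rewrite (big_cat_nat (n := `|q|)) //=; last exact: lqN.
rewrite [X in _ + X]big_nat_cond [X in _ + X]big1 ?addr0 // => i.
rewrite andbT => /andP[h1 h2]; rewrite e_neg ?h0 //; lia.
Qed.

(** The lowering relations are hypotheses because the case m = -1 serves in the induction that
    proves them. Both tails of the sum equal the raising sum, and the factor 1/2 cancels the
    doubling. *)
Lemma osc_vir_raise (n : nat) (m : int) : -1 <= m ->
  (forall k : nat, h k (e n) = e (n%:Z - k%:Z)) ->
  (forall k l : nat, h k (e (n%:Z - l%:Z)) = e (n%:Z - l%:Z - k%:Z)) ->
  osc_vir m (e n) =
    ((m + 1)%:~R / 2) *: e (n%:Z - m) + osc_raise `|n%:Z - m| (n%:Z - m).
Proof.
move=> m1 hn hnl; rewrite /osc_vir.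
have half (u : V) : 2^-1 *: (u *+ 2) = u.
  by rewrite -scaler_nat scalerA mulVf ?scale1r // pnatr_eq0.
case: eqP => [->|m0].
  rewrite (@fsbig_int _ _ n.+1 n).
  - rewrite big_ord_recl subr0 add0r hn subr0 oppr0.
    have -> : h 0 (e n) = e n by rewrite (hn 0%N) subr0.
    rewrite (_ : \sum_(i < n) _ = osc_raise n n); last first.
      apply: eq_bigr => i _; rewrite lift0 hn; congr (h _ (e _)); lia.
    by rewrite -addrA scalerDr -mulr2n half absz_nat div1r.
  - move=> i ni; rewrite hn e_neg ?h0 //; lia.
  - move=> i ni; rewrite NegzE normrN hn e_neg ?h0 //; lia.
(* [M] = m + 1 counts the k with k and m - k both nonnegative. As m is not 0, [M] is not 1, which
   makes the commutators in the negative tail vanish. *)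
pose M := `|m + 1 : int|%N; have mE : m = M%:Z - 1 by rewrite /M; lia.
have M1 : M <> 1%N by move=> ME; apply: m0; rewrite mE ME.
pose q : int := n%:Z - m; pose N : nat := `|q|%N; have q0 : q <= N by lia.
rewrite (@fsbig_int _ _ (M + N) N).
- rewrite big_split_ord /=.
  rewrite (eq_bigr (fun _ => e q)); last first.
    move=> i _ /=; rewrite hn.
    have -> : m - i%:Z = (M - 1 - i)%N by have := ltn_ord i; lia.
    rewrite hnl; congr e; have := ltn_ord i; rewrite /q; lia.
  rewrite (eq_bigr (fun j : 'I_N => h (Negz j) (e (q - 1 - j%:Z)))); last first.
    move=> i _; rewrite hn; congr (h _ (e _)); rewrite /q; lia.
  (* Here k < 0 and the lowering operator h(m - k) stands on the left, so it is moved past h(k). *)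
  rewrite [X in _ + X](eq_bigr (fun j : 'I_N => h (Negz j) (e (q - 1 - j%:Z)))); last first.
    move=> i _.
    have -> : m - Negz i = (M + i)%N by rewrite NegzE; lia.
    rewrite h_comm hn (_ : (M + i == i.+1)%N = false); last by apply/eqP; lia.
    rewrite mulr0n scale0r addr0; congr (h _ (e _)); rewrite /q; lia.
  rewrite osc_raise_widen // -addrA -mulr2n scalerDr half sumr_const card_ord.
  congr (_ + _); rewrite -scaler_nat scalerA mulrC; congr (_ / _ *: _).
  by rewrite mE subrK.
- move=> i hi; rewrite hn.
  have -> : m - i%:Z = Negz (i - M)%N by lia.
  rewrite e_neg ?h0 //; lia.
- move=> i hi.
  have -> : m - Negz i = (M + i)%N by rewrite NegzE; lia.
  rewrite h_comm hn (_ : (M + i == i.+1)%N = false); last by apply/eqP; lia.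
  rewrite mulr0n scale0r addr0 e_neg ?h0 //; lia.
Qed.

(** Allows passing between iterates of L(-1) and divided powers without knowing that the sums are
    finite. *)
Lemma osc_virZ n (c : K) u : c != 0 -> osc_vir n (c *: u) = c *: osc_vir n u.
Proof.
move=> c0; rewrite /osc_vir scalerA [c * _]mulrC -scalerA; congr (_ *: _).
case: ifP => _; rewrite -fsbig_scaler //; apply: eq_fsbigr => k _; rewrite !hZ //.
Qed.

Let fact0 n : (n`!%:R : K) != 0.
Proof. by rewrite pnatr_eq0 -lt0n fact_gt0. Qed.

Lemma osc_expS (n : nat) : osc_vir (-1) (e n) = n.+1%:R *: e n.+1.
Proof.
rewrite /e osc_virZ ?invr_eq0 // [iter n.+1 _ _]iterS [RHS]scalerA; congr (_ *: _).
by rewrite factS natrM invfM mulrA divff ?mul1r // pnatr_eq0.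
Qed.

(** At m = -1 the coefficient (m + 1) / 2 vanishes, so the raising sum at q + 1 is L(-1) e_q = (q +
    1) e_{q+1}. Lowering up to index n gives this relation up to n + 1. *)
Let osc_euler_of (n : nat) :
  (forall m k : nat, (m <= n)%N -> h k (e m) = e (m%:Z - k%:Z)) ->
  forall q : int, q <= n.+1 -> osc_raise `|q| q = q%:~R *: e q.
Proof.
move=> IH [[|q]|q] qn.
- by rewrite /osc_raise big_ord0 scale0r.
- have qn' : (q <= n)%N by lia.
  have := @osc_vir_raise q (-1) isT.
  rewrite addNr mul0r scale0r add0r osc_expS (_ : q%:Z - -1 = q.+1); last by lia.
  move=> -> //; first by move=> k; apply: IH.
  move=> k l; case: (ltP (q%:Z - l%:Z) 0) => ql.
    rewrite !e_neg ?h0 //; lia.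
  have -> : q%:Z - l%:Z = (q - l)%N by lia.
  apply: IH; lia.
- rewrite e_neg // scaler0 /osc_raise big1 // => i _; rewrite e_neg ?h0 //; lia.
Qed.

(** Strong induction: h(k) applied to (n + 1) e_{n+1} = sum_j h(-j-1) e_{n-j} gives the raising sum
    at q = n + 1 - k, which is q e_q, plus the commutator k e_q from j = k - 1; altogether (n + 1)
    e_q. *)
Lemma osc_lower (n k : nat) : h k (e n) = e (n%:Z - k%:Z).
Proof.
move: {2}n (leqnn n) k => N; elim: N n => [|N IH] n nN k.
  have -> : n = 0%N by lia.
  rewrite /e /= hZ h_vac; case: k => [|k] /=; rewrite ?scaler0 //.
case: n nN => [|n] nN; first by apply: IH.
have IH' (m j : nat) : (m <= n)%N -> h j (e m) = e (m%:Z - j%:Z) by move=> mn; apply: IH; lia.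
have eul := osc_euler_of IH'.
have n0 : (n.+1%:R : K) != 0 by rewrite pnatr_eq0.
apply: (scalerI n0); rewrite -hZ.
have := eul n.+1 (lexx _); rewrite absz_nat => <-.
rewrite /osc_raise linear_sum_morph //.
pose q := n.+1%:Z - k%:Z.
rewrite (eq_bigr (fun j : 'I_n.+1 => h (Negz j) (e (q - 1 - j%:Z)) +
   (k%:R *+ (k == j.+1)) *: e (n%:Z - j%:Z))); last first.
  move=> j _; rewrite h_comm; have jn := ltn_ord j.
  have -> : n.+1%:Z - 1 - j%:Z = (n - j)%N by lia.
  rewrite IH'; last by lia.
  congr (h _ (e _) + _ *: e _); rewrite /q; lia.
rewrite big_split /= osc_raise_widen; last by rewrite /q; lia.
rewrite eul; last by rewrite /q; lia.
case: k @q => [|k] q.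
  rewrite big1 ?addr0 => [|i _]; last by rewrite mulr0n scale0r.
  by rewrite /q subr0.
(* The operator is now h(k + 1). For k > n no commutator survives and q < 0; otherwise only j = k
   contributes. *)
case: (ltnP n k) => nk.
  rewrite big1 => [|i _]; first by rewrite !e_neg ?scaler0 ?addr0 //; lia.
  rewrite (_ : _ == _ = false) ?mulr0n ?scale0r //; apply/eqP; have := ltn_ord i; lia.
have kn : (k < n.+1)%N by lia.
rewrite (bigD1 (Ordinal kn)) //= eqxx mulr1n big1 ?addr0 => [|i ik].
  have -> : n%:Z - k%:Z = q by rewrite /q; lia.
  rewrite -scalerDl; congr (_ *: _).
  by rewrite -[k.+1%:R]/(k.+1%:Z%:~R) -intrD /q subrK.
rewrite (_ : _ == _ = false) ?mulr0n ?scale0r //.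
by apply: contraNF ik; rewrite eqSS -val_eqE eq_sym.
Qed.

Lemma osc_euler (q : int) : osc_raise `|q| q = q%:~R *: e q.
Proof.
apply: (@osc_euler_of `|q|%N) => [m k _|]; [exact: osc_lower|lia].
Qed.

Lemma osc_vir_exp (n : nat) (m : int) : -1 <= m ->
  osc_vir m (e n) = (((m + 1)%:~R / 2) + (n%:Z - m)%:~R) *: e (n%:Z - m).
Proof.
move=> m1; rewrite osc_vir_raise //.
- by rewrite osc_euler -scalerDl.
- exact: osc_lower.
- move=> k l; case: (ltP (n%:Z - l%:Z) 0) => nl.
    rewrite !e_neg ?h0 //; lia.
  have -> : n%:Z - l%:Z = (n - l)%N by lia.
  exact: osc_lower.
Qed.

Lemma osc_exp_raise (n : nat) :
  n.+1%:R *: e n.+1 = \sum_(j < n.+1) h (Negz j) (e (n - j)%N).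
Proof.
have := osc_euler n.+1; rewrite absz_nat => <-.
apply: eq_bigr => j _; congr (h _ (e _)); have := ltn_ord j; lia.
Qed.

Lemma osc_iter_exp n : iter n (osc_vir (-1)) v0 = n`!%:R *: e n.
Proof. by rewrite /e scalerA divff ?scale1r. Qed.

Lemma osc_vir_iter (n : nat) (m : int) : -1 <= m ->
  osc_vir m (iter n (osc_vir (-1)) v0) =
    (n`!%:R * ((m + 1)%:~R / 2 + (n%:Z - m)%:~R)) *: e (n%:Z - m).
Proof. by move=> m1; rewrite osc_iter_exp osc_virZ // osc_vir_exp // scalerA. Qed.

End Oscillator.

(** * Powers and exponentials of formal power series *)

Section PowerSeries.
Variables (K : numFieldType) (A : comAlgType K).
Implicit Types s : nat -> A.

Lemma fps_powS s k n :
  fps_pow s k.+1 n = \sum_(i < n.+1) s i * fps_pow s k (n - i).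
Proof. by []. Qed.

(** Coefficients below N depend only on coefficients below N; the truncated polynomial gives access
    to derivatives. *)
Lemma fps_pow_poly s N k n : (n < N)%N ->
  fps_pow s k n = ((\poly_(i < N) s i) ^+ k)`_n.
Proof.
elim: k n => [|k IH] n nN; first by rewrite expr0 coef1.
rewrite exprS coefM fps_powS; apply: eq_bigr => i _; have := ltn_ord i => iN.
by rewrite coef_poly IH; [case: ifP => //|]; lia.
Qed.

(** The coefficient of t^n in the rule that s^(k+1) has derivative (k + 1) s' s^k. *)
Lemma fps_pow_deriv s k n :
  fps_pow s k.+1 n.+1 *+ n.+1 =
  (\sum_(j < n.+1) (s j.+1 *+ j.+1) * fps_pow s k (n - j)) *+ k.+1.
Proof.
rewrite (@fps_pow_poly _ n.+2) // -coef_deriv deriv_exp /= coefMn; congr (_ *+ _).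
rewrite coefM; apply: eq_bigr => j _; have := ltn_ord j => jn.
rewrite coef_deriv coef_poly (@fps_pow_poly _ n.+2); last by lia.
by rewrite ltnS jn.
Qed.

Lemma fps_pow_gt s k n : s 0%N = 0 -> (n < k)%N -> fps_pow s k n = 0.
Proof.
move=> s0; elim: k n => [//|k IH] n nk.
rewrite fps_powS big_ord_recl s0 mul0r add0r big1 // => i _.
by rewrite IH ?mulr0 //; have := ltn_ord i; rewrite /= /bump; lia.
Qed.

Lemma fps_expE s N n : s 0%N = 0 -> (n < N)%N ->
  fps_exp s n = \sum_(k < N) (k`!%:R : K)^-1 *: fps_pow s k n.
Proof.
move=> s0 nN; rewrite /fps_exp (@fsbigE _ _ _ _ _ (iota 0 N)) ?iota_uniq //.
  rewrite (eq_bigl xpredT); last by move=> i; rewrite mem_set.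
  by rewrite -(big_mkord xpredT (fun k => (k`!%:R : K)^-1 *: fps_pow s k n)) /index_iota subn0.
move=> i _; rewrite mem_iota /= add0n -leqNgt => Ni.
by rewrite fps_pow_gt ?scaler0 //; lia.
Qed.

Lemma fps_exp0 s : s 0%N = 0 -> fps_exp s 0 = 1.
Proof. by move=> s0; rewrite (@fps_expE _ 1) // big_ord1 invr1 scale1r. Qed.

(* (exp s)' = s' exp s *)
Lemma fps_exp_deriv s n : s 0%N = 0 ->
  n.+1%:R *: fps_exp s n.+1 =
  \sum_(j < n.+1) (j.+1%:R *: s j.+1) * fps_exp s (n - j).
Proof.
(* The k = 0 term is the constant series 1, without coefficient in degree n + 1; the others match
   the right side after shifting k by one. *)
move=> s0; rewrite (@fps_expE _ n.+2) // big_ord_recl /= scaler0 add0r scaler_sumr.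
under [RHS]eq_bigr => j _.
  rewrite (@fps_expE _ n.+1) //; last by have := ltn_ord j; lia.
  rewrite mulr_sumr; over.
rewrite exchange_big /=; apply: eq_bigr => k _.
rewrite /bump leq0n add1n scalerA mulrC -scalerA scaler_nat fps_pow_deriv.
rewrite -scaler_nat scalerA factS natrM invfM.
rewrite mulrC mulrA divff ?mul1r ?pnatr_eq0 // scaler_sumr.
by apply: eq_bigr => j _; rewrite -scaler_nat scalerAr.
Qed.

End PowerSeries.

(** * Polynomial sequences with one member in each degree *)

Section PolyBasis.
Variables (K : fieldType) (p : nat -> {poly K}).
Hypothesis size_p : forall n, size (p n) = n.+1.

(** Induction on the size: subtracting a multiple of the p_k of the same degree cancels the leading
    term. *)
Lemma poly_basis_ext (V : lmodType K) (D1 D2 : {poly K} -> V) :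
  linear D1 -> linear D2 -> (forall n, D1 (p n) = D2 (p n)) -> D1 =1 D2.
Proof.
move=> l1 l2 D12 q.
have [n] := ubnP (size q); elim: n q => // n IH q; rewrite ltnS => qn.
have [->|q0] := eqVneq q 0; first by rewrite !linear_zero.
pose k := (size q).-1; have sq : size q = k.+1 by rewrite prednK // size_poly_gt0.
pose c := lead_coef q / lead_coef (p k).
have pk0 : lead_coef (p k) != 0 by rewrite lead_coef_eq0 -size_poly_gt0 size_p.
pose r := q - c *: p k.
have -> : q = c *: p k + r by rewrite /r addrC subrK.
rewrite l1 l2 D12 IH //; apply: leq_trans qn; rewrite sq ltnS.
apply/leq_sizeP => j; rewrite leq_eqVlt => /predU1P[<-|kj].
  rewrite coefB coefZ; have := mulfVK pk0 (lead_coef q).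
  by rewrite -/c !lead_coefE sq size_p /= => ->; rewrite subrr.
by rewrite coefB coefZ !nth_default ?sq ?size_p // mulr0 subr0.
Qed.

(** Forward substitution in a triangular system with nonzero diagonal; w i is the value at X^i of
    the linear map sending p n to v n. *)
Lemma poly_basis_triangular (V : lmodType K) (v : nat -> V) :
  exists w : nat -> V, forall n, \sum_(i < n.+1) (p n)`_i *: w i = v n.
Proof.
(* [next] solves for the value at X^(size s) from the earlier ones, which it leaves unchanged. *)
pose next (s : seq V) :=
  rcons s (((p (size s))`_(size s))^-1 *:
           (v (size s) - \sum_(i < size s) (p (size s))`_i *: s`_i)).
pose ws n := iter n next [::].
have wsS n : ws n.+1 = next (ws n) by [].
have sws n : size (ws n) = n by elim: n => // n IH; rewrite wsS size_rcons IH.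
have wsE n i d : (i < n)%N -> (ws (n + d)%N)`_i = (ws n)`_i.
  move=> im; elim: d => [|d IH]; first by rewrite addn0.
  rewrite addnS wsS nth_rcons sws ifT //; lia.
have pnn n : (p n)`_n != 0.
  have := lead_coef_eq0 (p n); rewrite lead_coefE size_p /= => ->.
  by rewrite -size_poly_gt0 size_p.
exists (fun i => (ws i.+1)`_i) => n.
rewrite big_ord_recr.
have -> : (ws n.+1)`_n =
    ((p n)`_n)^-1 *: (v n - \sum_(i < n) (p n)`_i *: (ws n)`_i).
  by rewrite wsS nth_rcons sws ltnn eqxx.
rewrite [(p n)`_n *: _]scalerA divff // scale1r.
rewrite (eq_bigr (fun i : 'I_n => (p n)`_i *: (ws n)`_i)); last first.
  move=> i _; congr (_ *: _).
  by have := wsE i.+1 i (n - i.+1)%N (leqnn _); rewrite subnKC.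
exact: (etrans (addrC _ _) (subrK _ _)).
Qed.

Lemma poly_basis_linear (V : lmodType K) (v : nat -> V) :
  exists D : {poly K} -> V, linear D /\ forall n, D (p n) = v n.
Proof.
have [w wE] := poly_basis_triangular v.
have DE (q : {poly K}) N : (size q <= N)%N ->
    \sum_(i < size q) q`_i *: w i = \sum_(i < N) q`_i *: w i.
  move=> qN; rewrite (big_ord_widen N (fun i => q`_i *: w i)) // big_mkcond.
  apply: eq_bigr => i _; case: ltnP => // qi.
  by rewrite nth_default // scale0r.
exists (fun q => \sum_(i < size q) q`_i *: w i); split=> [c q r|n]; last first.
  by rewrite size_p wE.
pose N := (size (c *: q + r)%R + size q + size r)%N.
rewrite (@DE _ N) ?(@DE q N) ?(@DE r N) /N; try by lia.
rewrite scaler_sumr -big_split; apply: eq_bigr => i _.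
by rewrite coefD coefZ scalerDl scalerA.
Qed.

End PolyBasis.

(** * Multiplications and derivations as a Heisenberg representation *)

Section Weyl.
Variables (K : numFieldType) (A : comAlgType K).
Variables (x : nat -> A) (d : nat -> A -> A).
Hypothesis d_lin : forall i, linear (d i).
Hypothesis dM : forall i j p, d i (x j * p) = (j == i)%:R *: p + x j * d i p.
Hypothesis d1 : forall i, d i 1 = 0.

Definition weyl_osc (n : int) (p : A) : A :=
  match n with
  | Posz 0 => x 0 * d 0 p
  | Posz k => k`!%:R *: d k p
  | Negz k => (k`!%:R)^-1 *: (x k.+1 * p)
  end.

Lemma weyl_osc_linear n : linear (weyl_osc n).
Proof.
case: n => [[|k]|k] c p q /=.
- by rewrite d_lin mulrDr scalerAr.
- by rewrite d_lin scalerDr !scalerA mulrC.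
- by rewrite mulrDr -scalerAr scalerDr !scalerA mulrC.
Qed.

(** For a = b + 1 the factorials leave a! / b! = a; h(0) = y d/dy commutes with every x_j, as these
    differ from y. *)
Lemma weyl_osc_comm (a b : nat) u :
  weyl_osc a (weyl_osc (Negz b) u) =
  weyl_osc (Negz b) (weyl_osc a u) + (a%:R *+ (a == b.+1)) *: u.
Proof.
have dZ i c p : d i (c *: p) = c *: d i p by exact: linear_scale.
case: a => [|a] /=.
  rewrite mulr0n scale0r addr0 dZ dM scale0r add0r -scalerAr; congr (_ *: _).
  by rewrite mulrCA.
rewrite dZ dM scalerA mulrC -scalerA -!scalerAr !scalerDr addrC; congr (_ + _).
rewrite eq_sym eqSS; case: eqP => [->|_]; last by rewrite mulr0n !scale0r !scaler0.
rewrite mulr1n scale1r scalerA factS natrM mulrCA mulVf ?mulr1 //.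
by rewrite pnatr_eq0 -lt0n fact_gt0.
Qed.

Lemma weyl_osc_vac (a : nat) : weyl_osc a (x 0) = if a == 0%N then x 0 else 0.
Proof.
have dx i : d i (x 0) = (0%N == i)%:R.
  by rewrite -[x 0]mulr1 dM d1 mulr0 addr0 scaler_nat.
case: a => [|a] /=; rewrite dx ?mulr1 //= scaler0 //.
Qed.

End Weyl.

(** * Partial derivatives in the polynomial ring *)

(* Rewriting with goals in which the monoid algebra is visible makes unification
   unfold its operations, hence the proofs by explicit terms. *)
Section Monalg.
Variable K : numFieldType.
Local Notation P := {malg K[{cmonom nat}]}.
Implicit Types (u v : {cmonom nat}) (a b c : K) (p q : P).

Lemma malg_scale_U u c a : c *: << a *g u >> = << c * a *g u >> :> P.
Proof.
apply/malgP => v; transitivity (c * (a *+ (u == v))).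
  exact: etrans (mcoeffZ c (<< a *g u >> : P) v) (congr1 _ (mcoeffU u a v)).
exact: etrans (mulrnAr _ _ _) (esym (mcoeffU u (c * a) v)).
Qed.

Lemma malg_linear_ext (V : lmodType K) (f g : P -> V) :
  linear f -> linear g ->
  (forall c u, f << c *g u >> = g << c *g u >>) -> f =1 g.
Proof.
move=> lf lg fg p.
apply: etrans (congr1 f (monalgE p)) (etrans _ (congr1 g (esym (monalgE p)))).
apply: etrans (linear_sum_morph _ _ lf) (etrans _ (esym (linear_sum_morph _ _ lg))).
by apply: eq_bigr => u _; apply: fg.
Qed.

Lemma partialEw i p (s : {fset {cmonom nat}}) :
  (msupp p `<=` s)%fset ->
  partial i p = \sum_(u <- s) << (u i)%:R * p@_u *g divcm u (ucm i) >>.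
Proof.
move=> ps; apply: big_fset_incl => // u _ up.
have -> : (u i)%:R * p@_u = 0 by rewrite mcoeff_outdom // mulr0.
exact: monalgU0.
Qed.

Lemma partial_linear i : linear (@partial K i).
Proof.
move=> c p q.
pose s := (msupp (c *: p + q) `|` (msupp p `|` msupp q))%fset.
have sp : (msupp p `<=` s)%fset.
  exact: fsubset_trans (fsubsetUl _ _) (fsubsetUr _ _).
have sq : (msupp q `<=` s)%fset.
  exact: fsubset_trans (fsubsetUr _ _) (fsubsetUr _ _).
have spq : (msupp (c *: p + q) `<=` s)%fset by apply: fsubsetUl.
apply: etrans (partialEw i spq) _.
apply: etrans _
  (congr2 (fun x y => c *: x + y) (esym (partialEw i sp)) (esym (partialEw i sq))).
apply: sum_linear => u.
have E : (u i)%:R * (c *: p + q)@_u = c * ((u i)%:R * p@_u) + (u i)%:R * q@_u.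
  have -> : (c *: p + q)@_u = c * p@_u + q@_u.
    exact: etrans (mcoeffD u (c *: p) q) (congr1 (fun z => z + _) (mcoeffZ c p u)).
  by rewrite mulrDr mulrCA.
apply: etrans (congr1 (fun z => << z *g divcm u (ucm i) >>) E) _.
apply: etrans (monalgUD _ _ _) _.
have Z := malg_scale_U (divcm u (ucm i)) c ((u i)%:R * p@_u).
by rewrite -Z.
Qed.

Lemma partialU i c u :
  partial i (<< c *g u >> : P) = << (u i)%:R * c *g divcm u (ucm i) >>.
Proof.
apply: etrans (partialEw i (@msuppU_le _ _ u c)) _.
rewrite big_seq_fset1.
by rewrite mcoeffUU.
Qed.

Lemma partial1 i : partial i (1 : P) = 0.
Proof.
have -> : (1 : P) = << (1 : K) *g (mone : {cmonom nat}) >> by [].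
by rewrite partialU cm1 mul0r monalgU0.
Qed.

Lemma varM j c u : var K j * << c *g u >> = << c *g (mmul (ucm j) u) >> :> P.
Proof.
apply: etrans (fgmulUU 1 c (ucm j) u) _.
by rewrite mul1r.
Qed.

Lemma divcm_mulU i j u :
  divcm (mmul (ucm j) u) (ucm i) = if j == i then u else (mmul (ucm j) (divcm u (ucm i))).
Proof.
apply/eqP/cmP => k; rewrite divcmE cmM !ucmE.
case: (eqVneq j i) => [->|ij]; first by rewrite addKn.
rewrite cmM divcmE !ucmE.
have [jk|jk] := eqVneq j k; have [ik|ik] := eqVneq i k; rewrite /= ?subn0 //.
by case/eqP: ij; rewrite jk ik.
Qed.

Lemma mul_divcmU i u : (0 < u i)%N -> (mmul (ucm i) (divcm u (ucm i))) = u.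
Proof.
move=> ui; apply/eqP/cmP => k; rewrite cmM divcmE !ucmE.
by case: (eqVneq i k) => [<-|_]; rewrite ?subn0 // subnKC.
Qed.

(** Supplies the hypothesis [dM] of the abstract setting; by linearity it is enough to treat
    monomials. *)
Lemma partial_varM i j p :
  partial i (var K j * p) = (j == i)%:R *: p + var K j * partial i p.
Proof.
have l1 (A : comAlgType K) (x : A) (d : A -> A) : linear d ->
    linear (fun p : A => d (x * p)).
  by move=> l c q r; rewrite mulrDr -scalerAr l.
have l2 (A : comAlgType K) (a : K) (x : A) (d : A -> A) : linear d ->
    linear (fun p : A => a *: p + x * d p).
  move=> l c q r; rewrite l mulrDr -scalerAr !scalerDr !scalerA.
  by rewrite addrACA [a * c]mulrC.
have dl := partial_linear i.
move: p; apply: (malg_linear_ext (l1 _ _ _ dl) (l2 _ _ _ _ dl)) => c u.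
have -> : partial i (var K j * << c *g u >>) =
   << ((mmul (ucm j) u) i)%:R * c *g divcm (mmul (ucm j) u) (ucm i) >>.
  exact: etrans (congr1 (partial i) (varM j c u)) (partialU i c _).
have -> : (j == i)%:R *: << c *g u >> + var K j * partial i << c *g u >> =
   << (j == i)%:R * c *g u >> +
   << (u i)%:R * c *g (mmul (ucm j) (divcm u (ucm i))) >> :> P.
  apply: congr2 (malg_scale_U _ _ _) _.
  exact: etrans (congr1 (fun z => var K j * z) (partialU i c u)) (varM j _ _).
rewrite divcm_mulU cmM ucmE; case: (eqVneq j i) => [->|_]; last first.
  rewrite add0n !mul0r; symmetry.
  by rewrite monalgU0 add0r.
have -> : << (u i)%:R * c *g (mmul (ucm i) (divcm u (ucm i))) >> =
          << (u i)%:R * c *g u >> :> P.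
  (* If the variable does not occur in u, the truncated quotient is not a true one, but its
     coefficient is 0. *)
  have [ui|ui] := posnP (u i); last by rewrite mul_divcmU.
  by rewrite ui mul0r !monalgU0.
rewrite natrD mulrDl; exact: monalgUD.
Qed.

End Monalg.

(** * The Heisenberg computation in the polynomial ring *)

Section Fock.
Variable K : numFieldType.
Local Notation P := {malg K[{cmonom nat}]}.

Let hE n (p : P) : h n p = weyl_osc (var K) (@partial K) n p.
Proof. by case: n => [[|k]|k]. Qed.

Lemma h_linear n : linear (@h K n).
Proof.
move=> c p q; rewrite !hE.
exact: (weyl_osc_linear (var K) (@partial_linear K)).
Qed.

Lemma h_comm (a b : nat) (u : P) :
  h a (h (Negz b) u) = h (Negz b) (h a u) + (a%:R *+ (a == b.+1)) *: u.
Proof.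
rewrite !hE; exact: (weyl_osc_comm (@partial_linear K) (@partial_varM K)).
Qed.

Lemma h_vac (a : nat) : h a (var K 0) = if a == 0%N then var K 0 else 0.
Proof. by rewrite hE; exact: (weyl_osc_vac (@partial_varM K) (@partial1 K)). Qed.

Definition fock_exp : int -> P := osc_exp (@h K) (var K 0).

Lemma Lm1_iter_exp n : Lm1_iter K n = n`!%:R *: fock_exp n.
Proof. exact: osc_iter_exp. Qed.

Lemma L_Lm1_iter (n : nat) (m : int) : -1 <= m ->
  L m (Lm1_iter K n) =
    (n`!%:R * ((m + 1)%:~R / 2 + (n%:Z - m)%:~R)) *: fock_exp (n%:Z - m).
Proof. exact: (osc_vir_iter h_linear h_comm h_vac). Qed.

Lemma fock_exp_raise (n : nat) :
  n.+1%:R *: fock_exp n.+1 = \sum_(j < n.+1) h (Negz j) (fock_exp (n - j)%N).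
Proof. exact: (osc_exp_raise h_linear h_comm h_vac). Qed.

End Fock.

(** * Closed form of the numbers f_m(n) *)

Section Coefficients.

(* The value 1 at m = -1 continues the formula: n (n - 1) ... (n - m + 1) is then
   1 / (n + 1), and the second factor is n + 1. *)
Definition vir_coef (m n : int) : rat :=
  if m is Posz k then (\prod_(i < k) (n - i%:Z)%:~R) * ((m + 1)%:~R / 2 + (n - m)%:~R)
  else 1.

Lemma vir_coef_rec (m n : int) : 0 <= m ->
  vir_coef m n = vir_coef m (n - 1) + (m + 1)%:~R * vir_coef (m - 1) (n - 1).
Proof.
case: m => [[|k]|k] // _.
  rewrite (_ : 0%:Z - 1 = Negz 0) // /vir_coef !big_ord0 !mul1r.
  by rewrite !subr0 rmorphB /=; ring.
rewrite (_ : k.+1%:Z - 1 = k); last by lia.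
rewrite /vir_coef big_ord_recl [in X in _ = X + _]big_ord_recr /=.
rewrite subr0.
rewrite (eq_bigr (fun i : 'I_k => (n - 1 - i%:Z)%:~R)); last first.
  move=> i _; congr (_%:~R); rewrite /bump leq0n add1n; lia.
(* All three products share p = (n - 1) ... (n - k); a polynomial identity in n and k remains. *)
set p := \prod_(i < k) _.
by rewrite intS !(rmorphB, rmorphD) /=; field.
Qed.

Lemma prod_falling (K : numFieldType) (n m : nat) : (m <= n)%N ->
  ratr (\prod_(i < m) (n%:Z - i%:Z)%:~R : rat) = n`!%:R / (n - m)`!%:R :> K.
Proof.
move=> mn; rewrite -(@ffact_fact n m) // natrM mulfK; last first.
  by rewrite pnatr_eq0 -lt0n fact_gt0.
rewrite ffact_prod natr_prod rmorph_prod /=; apply: eq_bigr => i _.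
by rewrite rmorph_int /= subzn // -?pmulrn //; have := ltn_ord i; lia.
Qed.

(** Passes from the coefficient at e_k, where k = n - m, to that at L(-1)^k y = k! e_k. *)
Lemma vir_coef_ratr (K : numFieldType) (n k : nat) (m : int) :
  -1 <= m -> n%:Z - m = k ->
  n`!%:R * ((m + 1)%:~R / 2 + k%:Z%:~R) = ratr (vir_coef m n) * k`!%:R :> K.
Proof.
case: m => [m|[|//]] _ mk.
  rewrite /vir_coef rmorphM /= prod_falling; last by lia.
  have -> : (n - m)%N = k by lia.
  rewrite mk [ratr (_ + _)]rmorphD /= fmorph_div !rmorph_int /= [RHS]mulrAC divfK ?ratr_nat //.
  by rewrite pnatr_eq0 -lt0n fact_gt0.
rewrite /vir_coef rmorph1 mul1r (_ : Negz 0 = -1) // addNr mul0r add0r.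
have -> : k = n.+1 by lia.
by rewrite factS mulrC natrM.
Qed.

End Coefficients.

Section FockCoef.
Variable K : numFieldType.

(** [xget] returns a solution once one exists; [vir_coef] is the witness. *)
Lemma fcoef_specP : fcoef_spec K (fcoef K).
Proof.
apply: (@xgetPex _ (fun _ _ => 0) (fcoef_spec K)); exists vir_coef.
split.
- move=> m [n|n] m1 n0 mn; last by exfalso; move: n0.
  have [k kE] : exists k : nat, n%:Z - m = k by exists `|n%:Z - m|%N; lia.
  apply: etrans (L_Lm1_iter K n m1) _; rewrite kE !absz_nat.
  apply: etrans _ (congr1 ( *:%R (ratr (vir_coef m n))) (esym (Lm1_iter_exp K k))).
  exact: etrans (congr1 ( *:%R^~ _) (vir_coef_ratr _ m1 kE)) (esym (scalerA _ _ _)).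
- exact: vir_coef_rec.
- by [].
- change (vir_coef (Posz 0) 0 = 2^-1).
  by rewrite /vir_coef big_ord0 mul1r; apply/eqP.
- case=> [[|k]|k] //= _; rewrite big_ord_recl subrr mul0r mul0r //.
Qed.

(** For n < m the zero comes from e_{n-m} = 0, not from the value of [fcoef]. *)
Lemma L_Lm1_iter_coef (n : nat) (m : int) : -1 <= m ->
  L m (Lm1_iter K n) =
  if m <= n%:Z then ratr (fcoef K m n) *: Lm1_iter K `|n%:Z - m| else 0.
Proof.
move=> m1; case: ifP => [mn|/negbT].
  by case: fcoef_specP => /(_ m n m1 (le0z_nat n) mn) + _ _ _ _; rewrite absz_nat.
rewrite -ltNge => nm; apply: etrans (L_Lm1_iter K n m1) _.
have [k ->] : exists k, n%:Z - m = Negz k by exists `|m - n%:Z - 1 : int|%N; lia.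
exact: scaler0.
Qed.

End FockCoef.

(** * The substitution map and the umbral polynomials *)

Section Phi.
Variables (K : numFieldType) (B : nat -> K).
Local Notation P := {malg K[{cmonom nat}]}.

Definition phi_mon (u : {cmonom nat}) : {poly K} :=
  \prod_(i <- finsupp u) phi_var B i ^+ u i.

Lemma phi_monEw (u : {cmonom nat}) (s : {fset nat}) : (finsupp u `<=` s)%fset ->
  phi_mon u = \prod_(i <- s) phi_var B i ^+ u i.
Proof.
move=> us; apply: big_fset_incl => // i _ iu.
by have /eqP -> : u i == 0%N; [rewrite cmE_eq0|rewrite expr0].
Qed.

Lemma phi_monU i u : phi_mon (mmul (ucm i) u) = phi_var B i * phi_mon u.
Proof.
pose s := (finsupp (mmul (ucm i) u) `|` (i |` finsupp u))%fset.
rewrite (@phi_monEw _ s) ?fsubsetUl //.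
rewrite (@phi_monEw u s); last first.
  exact: fsubset_trans (fsubsetUr _ _) (fsubsetUr _ _).
have si : i \in s by rewrite !inE eqxx orbT.
rewrite !(big_fsetD1 i si) /= cmM ucmE eqxx exprS mulrA; congr (_ * _).
rewrite big_seq_cond [in RHS]big_seq_cond.
apply: eq_bigr => j /andP[]; rewrite !inE => /andP[ji _] _.
by rewrite cmM ucmE eq_sym (negbTE ji).
Qed.

Lemma phiEw (p : P) (s : {fset {cmonom nat}}) : (msupp p `<=` s)%fset ->
  phi B p = \sum_(u <- s) p@_u *: phi_mon u.
Proof.
move=> ps; refine (etrans (mmapEw ps) _).
by apply: eq_bigr => u _; exact: mul_polyC.
Qed.

Lemma phi_linear : linear (phi B).
Proof.
move=> c p q.
pose s := (msupp (c *: p + q) `|` (msupp p `|` msupp q))%fset.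
have sp : (msupp p `<=` s)%fset.
  exact: fsubset_trans (fsubsetUl _ _) (fsubsetUr _ _).
have sq : (msupp q `<=` s)%fset.
  exact: fsubset_trans (fsubsetUr _ _) (fsubsetUr _ _).
have spq : (msupp (c *: p + q) `<=` s)%fset by apply: fsubsetUl.
rewrite (phiEw spq) (phiEw sp) (phiEw sq).
apply: sum_linear => u.
have -> : (c *: p + q)@_u = c * p@_u + q@_u.
  exact: etrans (mcoeffD u (c *: p) q) (congr1 (+%R^~ _) (mcoeffZ c p u)).
by rewrite scalerDl scalerA.
Qed.

Lemma phiU c u : phi B (<< c *g u >> : P) = c *: phi_mon u.
Proof.
refine (etrans (mmapU _ _) (mul_polyC _ _)).
Qed.

Lemma phi_varM i (p : P) : phi B (var K i * p) = phi_var B i * phi B p.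
Proof.
have l1 (A : comAlgType K) (x : A) (f : A -> {poly K}) : linear f ->
    linear (fun p : A => f (x * p)).
  by move=> l c q r; rewrite mulrDr -scalerAr l.
have l2 (V : lmodType K) (x : {poly K}) (f : V -> {poly K}) : linear f ->
    linear (fun p => x * f p).
  by move=> l c q r; rewrite l mulrDr -scalerAr.
move: p; apply: (malg_linear_ext (l1 _ _ _ phi_linear) (l2 _ _ _ phi_linear)) => c u.
refine (etrans (congr1 (phi B) (varM i c u)) _).
refine (etrans (phiU c _) _).
refine (etrans _ (congr1 (fun z => phi_var B i * z) (esym (phiU c u)))).
by rewrite phi_monU scalerAr.
Qed.

Lemma phi_var0 : phi B (var K 0) = 1.
Proof.
refine (etrans (phiU 1 (ucm 0)) _).
by rewrite scale1r /phi_mon mdomU big_seq_fset1 cmUU.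
Qed.

Lemma phiZ c (p : P) : phi B (c *: p) = c *: phi B p.
Proof. exact: (linear_scale _ _ phi_linear). Qed.

(** The series x B(w), whose exponential generates the B_n(x). *)
Definition umbral_series (k : nat) : {poly K} := egf B k *: 'X.

(** h(-k-1) multiplies by x_{k+1} / k!, which maps to the coefficient of w^k in x B'(w). *)
Lemma phi_raise k (p : P) :
  phi B (h (Negz k) p) = (k.+1%:R *: umbral_series k.+1) * phi B p.
Proof.
refine (etrans (phiZ _ _) _).
refine (etrans (congr1 ( *:%R _) (phi_varM _ _)) _).
rewrite scalerAl; congr (_ * _); rewrite /phi_var /umbral_series /egf /= !scalerA.
congr (_ *: _); rewrite factS natrM invfM [RHS]mulrCA [X in _ = _ * X]mulrA.
by rewrite divff ?pnatr_eq0 // mul1r mulrC.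
Qed.

Hypothesis B0 : B 0%N = 0.

Let series0 : umbral_series 0 = 0.
Proof. by rewrite /umbral_series /egf B0 mul0r scale0r. Qed.

Let natr0 n : (n.+1%:R : K) != 0.
Proof. by rewrite pnatr_eq0. Qed.

Let fact0 n : (n`!%:R : K) != 0.
Proof. by rewrite pnatr_eq0 -lt0n fact_gt0. Qed.

(** Both sides satisfy the recurrence read off from F' = x B' F with F(0) = 1. *)
Lemma phi_fock_exp (n : nat) : phi B (fock_exp K n) = fps_exp umbral_series n.
Proof.
have [N] := ubnP n; elim: N n => // N IH [|n] nN.
  rewrite fps_exp0 //.
  refine (etrans (congr1 (phi B) (etrans _ (scale1r (var K 0)))) phi_var0).
  exact: (congr1 (fun c => c *: var K 0) (invr1 K)).
apply: (scalerI (natr0 n)); rewrite fps_exp_deriv //.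
refine (etrans (esym (phiZ _ _)) (etrans (congr1 (phi B) (fock_exp_raise K n)) _)).
refine (etrans (linear_sum_morph _ _ phi_linear) _).
apply: eq_bigr => j _; refine (etrans (phi_raise _ _) _).
by rewrite IH //; have := ltn_ord j; lia.
Qed.

Lemma phi_Lm1_iter n : phi B (Lm1_iter K n) = umbral B n.
Proof.
refine (etrans (congr1 (phi B) (Lm1_iter_exp K n)) (etrans (phiZ _ _) _)).
by rewrite phi_fock_exp.
Qed.

(** In the recurrence for (n + 1) F_{n+1} the term j = 0 is B_1 x F_n, of degree n + 1 as B_1 is
    nonzero; the others have degree at most n. *)
Lemma size_umbral n : B 1%N != 0 -> size (umbral B n) = n.+1.
Proof.
move=> B1; rewrite size_scale //.
have [N] := ubnP n; elim: N n => // N IH [|n] nN.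
  by rewrite fps_exp0 // size_poly1.
rewrite -(size_scale _ (natr0 n)) fps_exp_deriv // big_ord_recl subn0.
have sz : size (1%:R *: umbral_series 1 * fps_exp umbral_series n) = n.+2.
  rewrite scale1r /umbral_series /egf invr1 mulr1 -scalerAl mulrC size_scale //.
  by rewrite size_mulX ?IH // -size_poly_gt0 IH.
rewrite size_polyDl sz // ltnS; apply: leq_trans (size_sum _ _ _) _.
apply/bigmax_leqP => j _.
rewrite /umbral_series scalerA -scalerAl mulrC.
apply: leq_trans (size_scale_leq _ _) _.
apply: leq_trans (size_polyMleq _ _) _.
rewrite IH; last by rewrite /bump; lia.
by rewrite size_polyX lift0; have := ltn_ord j; lia.
Qed.

End Phi.

(** * Agreement of the two characterizations *)

Lemma umbral_shift_specP (K : numFieldType) (B : nat -> K) (m : int) D :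
  B 0%N = 0 -> -1 <= m ->
  umbral_shift_spec B m D <->
  linear D /\ forall n : nat,
    D (umbral B n) = ratr (fcoef K m n%:Z) *: umbralz B (n%:Z - m).
Proof.
move=> B0 m1.
(* For n < m both sides vanish: the left since L(m) L(-1)^n y = 0, the right by the convention on
   negative indices. *)
have E n : phi B (L m (Lm1_iter K n)) =
    ratr (fcoef K m n%:Z) *: umbralz B (n%:Z - m).
  refine (etrans (congr1 (phi B) (L_Lm1_iter_coef K n m1)) _).
  case: ifP => [mn|/negbT].
    refine (etrans (phiZ B _ _) _); rewrite phi_Lm1_iter //; congr (_ *: _).
    by have [k ->] : exists k : nat, n%:Z - m = k by exists `|n%:Z - m|%N; lia.
  rewrite -ltNge => nm.
  have [k ->] : exists k, n%:Z - m = Negz k by exists `|m - n%:Z - 1 : int|%N; lia.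
  rewrite scaler0 -(scale0r (phi B 0)) -phiZ; congr (phi B _).
  by rewrite scale0r.
split=> -[Dl DE]; split=> // n; have := DE n.
  by rewrite phi_Lm1_iter // E.
by rewrite phi_Lm1_iter // E.
Qed.

Theorem proposition7p1 (R : realType) (B : nat -> R[i]) (m : int) :
  B 0%N = 0 -> B 1%N != 0 -> -1 <= m ->
  unique
    (fun D : {poly R[i]} -> {poly R[i]} =>
       linear D /\
       forall n : nat,
         D (umbral B n) = ratr (fcoef R[i] m n%:Z) *: umbralz B (n%:Z - m))
    (umbral_shift B m).
Proof.
move=> B0 B1 m1.
have spec := umbral_shift_specP _ B0 m1.
have [D0 D0P] := poly_basis_linear (fun n => size_umbral B0 n B1)
  (fun n => ratr (fcoef R[i] m n%:Z) *: umbralz B (n%:Z - m)).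
have uniq D1 D2 : umbral_shift_spec B m D1 -> umbral_shift_spec B m D2 -> D1 = D2.
  move=> /spec [l1 E1] /spec [l2 E2]; apply/funext.
  apply: (poly_basis_ext (fun n => size_umbral B0 n B1) l1 l2) => n.
  by rewrite E1 E2.
(* Once a unique solution is known to exist, the [xget] in [umbral_shift] returns it and not its
   default. *)
have exU : exists D, unique (umbral_shift_spec B m) D.
  by exists D0; split; [apply/spec|move=> D; apply: uniq; apply/spec].
have [sh _] : unique (umbral_shift_spec B m) (umbral_shift B m).
  exact: (xgetPex (fun=> 0) exU).
by split; [apply/spec|move=> D /spec; apply: uniq].
Qed.
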